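(* Let $F$ be an infinite field and $R$ a finite-dimensional associative unital $F$-algebra with $F$-basis $a_1,\dots,a_m$. Let $x=\sum_{i=1}^m x_ia_i\in R\otimes_F F(x_1,\dots,x_m)$ be the generic element, let $P(t)$ be its minimal polynomial over $F(x_1,\dots,x_m)$, of degree $k$, and let $f:=(-1)^kP(0)$, viewed as a polynomial function $R\to F$ via $\sum_i\alpha_ia_i\mapsto f(\alpha_1,\dots,\alpha_m)$. Then $f$ is the unique minimal Cayley–Hamilton norm on $R$: every Cayley–Hamilton norm $N$ on $R$ is of the form $N=g\cdot f$ for some multiplicative polynomial function $g:R\to F$.
   Context: For a polynomial function $N:R\to F$ given in coordinates by $p\in F[x_1,\dots,x_m]$ and a commutative $F$-algebra $B$, let $N_B:R\otimes_FB\to B$, $\sum_i b_ia_i\mapsto p(b_1,\dots,b_m)$. A Cayley–Hamilton norm (CH-norm) on $R$ is a polynomial function $N:R\to F$ such that: (i) $N$ is homogeneous of some degree $n$; (ii) $N_B(ab)=N_B(a)N_B(b)$ for all commutative $F$-algebras $B$ and $a,b\in R\otimes_FB$; (iii) for every commutative $F$-algebra $B$, every $a\in R\otimes_FB$ satisfies $\chi_a(a)=0$ where $\chi_a(t):=N_{B[t]}(t-a)$. A polynomial function $g$ is multiplicative if $g(ab)=g(a)g(b)$ for all $a,b\in R$. *)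

(* Defs.v *)
From HB Require Import structures.
From mathcomp Require Import all_boot all_order all_algebra all_field.
From mathcomp Require Import mpoly.
Set Implicit Arguments. Unset Strict Implicit. Unset Printing Implicit Defensive.
Import GRing.Theory.
Local Open Scope ring_scope.

(* R : falgType F with basis b = (a_1,...,a_m).  Elements of R (x) B, for a
   commutative F-algebra B given by a ring morphism iota : F -> B, are
   represented by their coordinate row vectors in B^m w.r.t. the basis
   a_i (x) 1. *)
Section CoordAlgebra.
Variables (F : fieldType) (R : falgType F) (m : nat) (b : m.-tuple R).

Definition sc (i j k : 'I_m) : F := coord b k (tnth b i * tnth b j).

Definition coords (r : R) : 'I_m -> F := fun k => coord b k r.

Variables (B : comNzRingType) (iota : F -> B).

Definition tmul (u v : 'rV[B]_m) : 'rV[B]_m :=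
  \row_k \sum_i \sum_j u 0 i * v 0 j * iota (sc i j k).

Definition tone : 'rV[B]_m := \row_k iota (coord b k 1).

Fixpoint texp (u : 'rV[B]_m) (n : nat) : 'rV[B]_m :=
  if n is n'.+1 then tmul u (texp u n') else tone.

Definition peval (P : {poly B}) (u : 'rV[B]_m) : 'rV[B]_m :=
  \sum_(i < size P) P`_i *: texp u i.

Definition NB (p : {mpoly F[m]}) (u : 'rV[B]_m) : B :=
  mmap iota (fun i => u 0 i) p.

End CoordAlgebra.

Definition homog_deg (F : fieldType) (m : nat) (d : nat) (p : {mpoly F[m]}) :=
  all (fun mo : 'X_{1..m} => mdeg mo == d) (msupp p).

Definition tminus (F : fieldType) (R : falgType F) (m : nat) (b : m.-tuple R)
  (B : comNzRingType) (iota : F -> B) (u : 'rV[B]_m) : 'rV[{poly B}]_m :=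
  \row_k ('X * (iota (coord b k 1))%:P - (u 0 k)%:P).

Definition chi (F : fieldType) (R : falgType F) (m : nat) (b : m.-tuple R)
  (B : comNzRingType) (iota : F -> B) (p : {mpoly F[m]}) (u : 'rV[B]_m) : {poly B} :=
  NB (fun c => (iota c)%:P) p (tminus b iota u).

Definition is_CHnorm (F : fieldType) (R : falgType F) (m : nat) (b : m.-tuple R)
  (p : {mpoly F[m]}) : Prop :=
  (exists d : nat, homog_deg d p) /\
  (forall (B : comNzRingType) (iota : {rmorphism F -> B}) (u v : 'rV[B]_m),
      NB iota p (tmul b iota u v) = NB iota p u * NB iota p v) /\
  (forall (B : comNzRingType) (iota : {rmorphism F -> B}) (u : 'rV[B]_m),
      peval b iota (chi b iota p u) u = 0).

Definition multiplicative_pf (F : fieldType) (R : falgType F) (m : nat)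
  (b : m.-tuple R) (q : {mpoly F[m]}) : Prop :=
  forall r s : R, (q.@[coords b (r * s)]) = q.@[coords b r] * q.@[coords b s].

Definition genK (F : fieldType) (m : nat) := {fraction {mpoly F[m]}}.
Definition iotaK (F : fieldType) (m : nat) : F -> genK F m :=
  fun c => tofrac (c%:MP).
Definition generic_elt (F : fieldType) (m : nat) : 'rV[genK F m]_m :=
  \row_i (tofrac ('X_i : {mpoly F[m]})).

(* Main.v *)
Require Import Defs.
From HB Require Import structures.
From mathcomp Require Import all_boot all_order all_algebra all_field.
From mathcomp Require Import mpoly.
From mathcomp Require Import zify.
From Stdlib Require Classical_Prop.
Set Implicit Arguments. Unset Strict Implicit.
Import GRing.Theory.
Local Open Scope ring_scope.

(** Let [A = F[x_1, ..., x_m]] and [p_r(t)] be the specialization at [r] in [R] of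
    the minimal polynomial [p] of the generic element. It divides the
    characteristic polynomial of left multiplication, so by Gauss's lemma it has
    coefficients in [A], and it divides every polynomial over [A] killing the
    generic element. Minimality makes [p] equivariant under [r -> l r + c], that is
    [p_(l r + c)(l t + c) = l^k p_r(t)]; hence [f] is homogeneous and
    [f(t - r) = p_r(t)], which is the Cayley-Hamilton identity.

    For multiplicativity write [det L_x = w(x) f(x)]. For [a = T + r] with [det L_a]
    nonzero, [f(a(S + s)) / f(a)] is a monic divisor of the fixed polynomial
    [det L_(S + s)] in [F[S]], so that [f(a s) / f(a)] takes finitely many values as
    [T] varies; being a quotient of polynomials in [T], it is constant, and the top
    coefficients in [T] identify the constant as [f(s)].

    Finally, the characteristic polynomial of a Cayley-Hamilton norm [N] kills the
    generic element, hence is divisible by [p]; the constant terms give [N = g f],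
    and cancelling [f] shows that [g] is multiplicative. *)

(** * Polynomials over an infinite field *)

Lemma rmorph_mmap (n : nat) (R : nzRingType) (S T : comNzRingType)
    (g : {rmorphism S -> T}) (f : R -> S) (h : 'I_n -> S) (p : {mpoly R[n]}) :
  g (mmap f h p) = mmap (g \o f) (g \o h) p.
Proof.
rewrite rmorph_sum; apply: eq_bigr => mo _; rewrite rmorphM rmorph_prod.
by congr (_ * _); apply: eq_bigr => i _; rewrite rmorphXn.
Qed.

Lemma eq_mmap (n : nat) (R S : nzRingType) (f f' : R -> S) (h h' : 'I_n -> S)
    (p : {mpoly R[n]}) :
  f =1 f' -> h =1 h' -> mmap f h p = mmap f' h' p.
Proof.
move=> eqf eqh; apply: eq_bigr => mo _; rewrite eqf; congr (_ * _).
exact: mmap1_eq.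
Qed.

Lemma mmap_id (n : nat) (R : nzRingType) (p : {mpoly R[n]}) :
  mmap (@mpolyC n R) (fun i => 'X_i) p = p.
Proof.
rewrite [RHS]mpolyE; apply: eq_bigr => mo _.
by rewrite mmap1_id mul_mpolyC.
Qed.

Lemma monic_rdivP (A : nzRingType) (d q : {poly A}) : d \is monic ->
  exists h r, q = h * d + r /\ (size r < size d)%N.
Proof.
move=> dmon; exists (Pdiv.CommonRing.rdivp q d), (Pdiv.CommonRing.rmodp q d).
by split; [apply: Pdiv.RingMonic.rdivp_eq | rewrite Pdiv.CommonRing.ltn_rmodpN0 ?monic_neq0].
Qed.

Section InfiniteField.
Variable F : fieldType.
Hypothesis F_infinite : forall s : seq F, exists c : F, c \notin s.

Lemma uniq_seq_of_size (n : nat) : exists s : seq F, uniq s /\ size s = n.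
Proof.
elim: n => [|n [s [us <-]]]; first by exists [::].
by have [c cs] := F_infinite s; exists (c :: s); rewrite /= cs us.
Qed.

Lemma poly_nonroot (p : {poly F}) : p != 0 -> exists c, p.[c] != 0.
Proof.
move=> p0; have [s [us ss]] := uniq_seq_of_size (size p).
have [/hasP[c _ pc]|/hasPn ps] := boolP (has (fun c => p.[c] != 0) s).
  by exists c.
suff: (size s < size p)%N by rewrite ss ltnn.
by apply: max_poly_roots => //; apply/allP => c /ps; rewrite negbK.
Qed.

Lemma poly_fun_eq (p q : {poly F}) : (forall c, p.[c] = q.[c]) -> p = q.
Proof.
move=> pq; apply/eqP; rewrite -subr_eq0; apply/negPn/negP => /poly_nonroot[c].
by rewrite hornerD hornerN pq subrr eqxx.
Qed.

(** Induction on the number of variables. Read as a polynomial in the first variable, [p] has a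
    leading coefficient in the others that is nonzero at some point [v]; the specialization at [v]
    is then a nonzero univariate polynomial, which has a nonroot [c]. *)
Lemma mpoly_nonroot (n : nat) (p : {mpoly F[n]}) :
  p != 0 -> exists v, p.@[v] != 0.
Proof.
elim: n p => [|n IHn] p p0.
  exists (fun=> 0); apply: contraNneq p0 => pv; rewrite (mpolyE p) big1 // => mo _.
  have m0 (mo' : 'X_{1..0}) : mo' = 0%MM by apply/mnmP; case.
  apply/eqP; rewrite (m0 mo); move: pv; rewrite mevalE.
  have [->|pmo] := eqVneq p@_0 0; first by rewrite scale0r eqxx.
  have -> : msupp p = [:: 0%MM].
    apply: perm_small_eq => //; apply: uniq_perm => // mo'.
    by rewrite mcoeff_msupp (m0 mo') pmo inE eqxx.
  by rewrite big_seq1 big_ord0 mulr1 => /eqP; rewrite (negPf pmo).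
pose var i : {poly {mpoly F[n]}} :=
  if unlift ord0 i is Some j then ('X_j)%:P else 'X.
pose q := mmap (polyC \o @mpolyC n F) var p.
have q0 : q != 0.
  apply: contraNneq p0 => q0.
  (* [back] undoes the isolation of the first variable, so [q = 0] would give [p = 0]. *)
  pose w : {rmorphism {mpoly F[n]} -> {mpoly F[n.+1]}} :=
    mmap (@mpolyC n.+1 F) (fun j : 'I_n => 'X_(lift ord0 j)).
  pose back : {rmorphism {poly {mpoly F[n]}} -> {mpoly F[n.+1]}} :=
    horner_eval ('X_ord0 : {mpoly F[n.+1]}) \o map_poly w.
  have : back q = 0 by rewrite q0 rmorph0.
  rewrite rmorph_mmap => <-; rewrite -[X in X == _]mmap_id.
  apply/eqP/eq_mmap => [c|i] /=.
    by rewrite map_polyC /horner_eval hornerC /= [w _]mmapC.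
  rewrite /var; case: unliftP => [j ->|->].
    by rewrite map_polyC /horner_eval hornerC [RHS]mmapX mmap1U.
  by rewrite map_polyX /horner_eval hornerX.
have [v vq] : exists v, (lead_coef q).@[v] != 0.
  by apply: IHn; rewrite lead_coef_eq0.
have /poly_nonroot[c qc] : map_poly (meval v) q != 0.
  by apply: contraNneq vq => qv; rewrite lead_coefE -coef_map qv coef0.
exists (fun i => if unlift ord0 i is Some j then v j else c).
apply: contraNneq qc => pvc; 
pose e : {rmorphism {poly {mpoly F[n]}} -> F} := horner_eval c \o map_poly (meval v).
rewrite -[_.[c]]/(e q) rmorph_mmap.
rewrite -[0]pvc; apply/eqP/eq_mmap => [a|i] /=.
  by rewrite map_polyC /horner_eval hornerC /= mevalC.
rewrite /var; case: unliftP => [j _|_].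
  by rewrite map_polyC /horner_eval hornerC /= mevalXU.
by rewrite map_polyX /horner_eval hornerX.
Qed.

Lemma mpoly_fun_eq (n : nat) (p q : {mpoly F[n]}) :
  (forall v, p.@[v] = q.@[v]) -> p = q.
Proof.
move=> pq; apply/eqP; rewrite -subr_eq0; apply/negPn/negP => /mpoly_nonroot[v].
by rewrite mevalB pq subrr eqxx.
Qed.

End InfiniteField.

(** * Gauss's lemma *)

Lemma poly_scale_factor (A : comNzRingType) (d : A) (P : {poly A}) :
  (forall i, exists w, P`_i = d * w) -> exists P', P = d *: P'.
Proof.
elim/poly_ind: P => [|P c IHP] Pd; first by exists 0; rewrite scaler0.
have [P' ->] : exists P', P = d *: P'.
  by apply: IHP => i; have [w] := Pd i.+1; rewrite coefD coefMX coefC addr0; exists w.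
have [w] := Pd 0%N; rewrite coefD coefMX coefC add0r /= => ->.
by exists (P' * 'X + w%:P); rewrite scalerDr scalerAl -[d *: w%:P]mul_polyC -polyCM.
Qed.

(** Irreducibility over an arbitrary field is not decidable, hence the excluded middle. *)
Lemma irreducible_or_factor (F : fieldType) (p : {poly F}) : (1 < size p)%N ->
  irreducible_poly p \/
  exists q r, [/\ p = q * r, (1 < size q < size p)%N & (1 < size r < size p)%N].
Proof.
move=> sp; have p0 : p != 0 by rewrite -size_poly_gt0 ltnW.
have [irr|red] := Classical_Prop.classic (irreducible_poly p); [by left | right].
have [[q [q1 /dvdpP[r pE] qp]]|no] := Classical_Prop.classic
  (exists q : {poly F}, [/\ size q != 1%N, q %| p & ~~ (q %= p)]); last first.
  case: red; split=> // q q1 qp; apply/negPn/negP => nqp.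
  by apply: no; exists q.
have /norP[r0 q0] : ~~ ((r == 0) || (q == 0)) by rewrite -mulf_eq0 -pE.
have q2 : (1 < size q)%N by rewrite ltn_neqAle eq_sym q1 size_poly_gt0.
have qlt : (size q < size p)%N.
  have qp' : q %| p by rewrite pE dvdp_mull.
  by rewrite ltn_neqAle dvdp_leq // andbT dvdp_size_eqp.
exists q, r; rewrite q2 qlt; split; rewrite 1?mulrC //.
have := size_mul r0 q0; rewrite -pE; move: qlt q2; move: (size r) (size q) (size p) => a b c; lia.
Qed.

Lemma irreducible_factor (F : fieldType) (p : {poly F}) : (1 < size p)%N ->
  exists2 q : {poly F}, irreducible_poly q & q %| p.
Proof.
have [n] := ubnP (size p); elim: n p => // n IHn p; rewrite ltnS => pn sp.
have [irr|[q [r [pE /andP[q1 qp] _]]]] := irreducible_or_factor sp.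
  by exists p.
have [|//|q' irr q'q] := IHn q; first exact: leq_trans qp pn.
by exists q' => //; rewrite pE dvdp_mulr.
Qed.

(** Induction along a factorization [p = q * r]: a divisor [d] is the product of [gcdp d q], which
    divides [q], and of its cofactor, which divides [r]. Up to normalization it is thus a product of
    two entries of the lists for [q] and [r]. *)
Lemma monic_divisors_finite (F : fieldType) (p : {poly F}) : p != 0 ->
  exists s : seq {poly F}, forall d, d \is monic -> d %| p -> d \in s.
Proof.
have [n] := ubnP (size p); elim: n p => // n IHn p; rewrite ltnS => pn p0.
have [p1|p1] := leqP (size p) 1%N.
  exists [:: 1] => d dmon dp; rewrite inE -(eqp_monic dmon (monic1 _)).
  rewrite -size_poly_eq1 eqn_leq size_poly_gt0 monic_neq0 // andbT.
  exact: leq_trans (dvdp_leq p0 dp) p1.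
have [irr|[q [r [pE /andP[q1 qp] /andP[r1 rp]]]]] := irreducible_or_factor p1.
  exists [:: 1; (lead_coef p)^-1 *: p] => d dmon dp; rewrite !inE.
  have lp : lead_coef p != 0 by rewrite lead_coef_eq0.
  rewrite -(eqp_monic dmon (monic1 _)) -size_poly_eq1.
  have [//|d1] := eqVneq (size d) 1%N.
  rewrite /= -eqp_monic //.
    have [_ /(_ d d1 dp) dpE] := irr; rewrite (eqp_ltrans dpE) eqp_sym.
    by rewrite eqp_scale ?invr_neq0.
  by rewrite monicE lead_coefZ mulVf.
have q0 : q != 0 by rewrite -size_poly_gt0 ltnW.
have r0 : r != 0 by rewrite -size_poly_gt0 ltnW.
have [s1 s1P] := IHn q (leq_trans qp pn) q0.
have [s2 s2P] := IHn r (leq_trans rp pn) r0.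
exists [seq d1 * d2 | d1 <- s1, d2 <- s2] => d dmon; rewrite pE => dqr.
have d0 := monic_neq0 dmon.
pose g := gcdp d q; pose e := d %/ g.
have g0 : g != 0 by rewrite gcdp_eq0 negb_and d0.
have dE : d = e * g by rewrite divpK // dvdp_gcdl.
have e0 : e != 0 by apply: contraNneq d0 => e0; rewrite dE e0 mul0r.
(* After cancelling [g], the cofactor [e] divides [(q %/ g) * r] and is coprime to [q %/ g]. *)
have er : e %| r.
  have qE : q = (q %/ g) * g by rewrite divpK // dvdp_gcdr.
  move: dqr; rewrite {1}dE {1}qE mulrAC dvdp_mul2r // Gauss_dvdpr //.
  by apply: coprimep_div_gcd; rewrite d0.
have unitn (u : {poly F}) : u != 0 -> (lead_coef u)^-1 *: u \is monic.
  by move=> u0; rewrite monicE lead_coefZ mulVf // lead_coef_eq0.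
have unitd (u : {poly F}) : u != 0 -> (lead_coef u)^-1 *: u %= u.
  by move=> u0; rewrite eqp_scale // invr_neq0 // lead_coef_eq0.
apply/allpairsP; exists ((lead_coef g)^-1 *: g, (lead_coef e)^-1 *: e); split=> /=.
- by apply: s1P; rewrite ?unitn // (eqp_dvdl _ (unitd g g0)) dvdp_gcdr.
- by apply: s2P; rewrite ?unitn // (eqp_dvdl _ (unitd e e0)).
apply/eqP; rewrite -eqp_monic ?monicMr ?unitn //.
by rewrite {1}dE mulrC eqp_sym (eqp_trans (eqp_mulr _ (unitd g g0))) // eqp_mull // unitd.
Qed.

(** Otherwise let [i] and [j] be the last indices at which [d] fails to divide a coefficient of [P]
    and of [Q]. Modulo [d] the coefficient of [P * Q] at [i + j] is the product of these two, and
    [d] is prime. *)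
Lemma irreducible_dvd_coefM (F : fieldType) (d : {poly F}) (P Q : {poly {poly F}}) :
  irreducible_poly d -> (forall i, d %| (P * Q)`_i) ->
  (forall i, d %| P`_i) \/ (forall i, d %| Q`_i).
Proof.
move=> irr dPQ.
have dprime (u v : {poly F}) : ~~ (d %| u) -> ~~ (d %| v) -> ~~ (d %| u * v).
  by move=> du dv; rewrite Gauss_dvdpr // irreducible_poly_coprime.
have last_bad (U : {poly {poly F}}) : (forall i, d %| U`_i) \/
    exists i, ~~ (d %| U`_i) /\ forall j, (i < j)%N -> d %| U`_j.
  have [ex|no] := Classical_Prop.classic (exists i, ~~ (d %| U`_i)); last first.
    by left=> i; apply/negPn/negP => bad; apply: no; exists i.
  right; have bnd i : ~~ (d %| U`_i) -> (i <= size U)%N.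
    by apply: contraR; rewrite -ltnNge => /ltnW Ui; rewrite nth_default ?dvdp0.
  case: (ex_maxnP ex bnd) => i bad maxi; exists i; split=> // j ij.
  by apply/negPn/negP => /maxi; rewrite leqNgt ij.
have [|[i [Pi Pgt]]] := last_bad P; first by left.
have [|[j [Qj Qgt]]] := last_bad Q; first by right.
have li : (i < (i + j).+1)%N by rewrite ltnS leq_addr.
have := dPQ (i + j)%N; rewrite coefM (bigD1 (Ordinal li)) //= addKn dvdp_addl.
  by rewrite (negPf (dprime _ _ Pi Qj)).
apply: (big_ind (fun u : {poly F} => d %| u)) => [|u v|l lne]; [exact: dvdp0 | exact: dvdp_add |].
have [il|il] := ltnP i l; first by rewrite dvdp_mulr // Pgt.
have {}il : (l < i)%N by rewrite ltn_neqAle il andbT; apply: contraNneq lne => lE; apply/eqP/val_inj.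
by rewrite dvdp_mull // Qgt //; move: il; lia.
Qed.

(** The equation says that the monic normalizations of [P] and [Q] have an integral product. An
    irreducible factor [d] of the leading coefficient of [P] divides all coefficients of [P * Q],
    hence all those of [P] or all those of [Q]; cancelling [d] there lowers the total degree of the
    two leading coefficients. *)
Lemma gauss_dvd_coef (F : fieldType) (P Q C : {poly {poly F}}) :
  P != 0 -> Q != 0 -> (lead_coef P * lead_coef Q) *: C = P * Q ->
  forall i, lead_coef P %| P`_i.
Proof.
have [n] := ubnP (size (lead_coef P) + size (lead_coef Q)).
elim: n P Q => // n IHn P Q; rewrite ltnS => sn P0 Q0 PQC i.
have lP0 : lead_coef P != 0 by rewrite lead_coef_eq0.
have lQ0 : lead_coef Q != 0 by rewrite lead_coef_eq0.
have [lP1|lP1] := leqP (size (lead_coef P)) 1%N.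
  rewrite (@eqp_dvdl _ 1) ?dvd1p // -size_poly_eq1.
  by rewrite eqn_leq lP1 size_poly_gt0.
have [d irr dlP] := irreducible_factor lP1.
have d0 := irredp_neq0 irr.
have dlt (u : {poly F}) : u != 0 -> (size u < size (d * u)%R)%N.
  move=> u0; rewrite size_mul //; case: (irr); case: (size d) => [|[|k]] // _ _.
  by rewrite !addSn ltnS /= leq_addl.
have dI (U V : {poly {poly F}}) : d *: U = d *: V -> U = V.
  by rewrite -!mul_polyC; apply: mulfI; rewrite polyC_eq0.
have extract (U : {poly {poly F}}) : (forall j, d %| U`_j) ->
    exists U', U = d *: U'.
  by move=> dU; apply: poly_scale_factor => j; have /dvdpP[w ->] := dU j; exists w; rewrite mulrC.
have [j|/extract[P' PE]|/extract[Q' QE]] := @irreducible_dvd_coefM _ d P Q irr.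
- by rewrite -PQC coefZ dvdp_mulr // dvdp_mulr.
- have P'0 : P' != 0 by apply: contraNneq P0 => P'0; rewrite PE P'0 scaler0.
  have lP'0 : lead_coef P' != 0 by rewrite lead_coef_eq0.
  rewrite PE lead_coefZ coefZ dvdp_mul2l //; apply: (IHn P' Q) => //.
    by apply: leq_trans sn; rewrite ltn_add2r PE lead_coefZ dlt.
  apply: dI; rewrite [RHS]scalerAl -PE -PQC scalerA; congr (_ *: _).
  by rewrite PE lead_coefZ mulrA.
- have Q'0 : Q' != 0 by apply: contraNneq Q0 => Q'0; rewrite QE Q'0 scaler0.
  have lQ'0 : lead_coef Q' != 0 by rewrite lead_coef_eq0.
  apply: (IHn P Q') => //.
    by apply: leq_trans sn; rewrite ltn_add2l QE lead_coefZ dlt.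
  apply: dI; rewrite [RHS]scalerAr -QE -PQC scalerA; congr (_ *: _).
  by rewrite QE lead_coefZ mulrCA.
Qed.

Lemma fracP (A : idomainType) (c : {fraction A}) :
  exists n d, d != 0 /\ tofrac d * c = tofrac n.
Proof.
elim/quotW: c => x; exists (frac x).1, (frac x).2; split; first exact: denom_ratioP.
unlock FracField.tofrac; rewrite -[LHS]FracField.pi_mul; apply/eqmodP => /=.
rewrite FracField.equivfE /FracField.mulf !numden_Ratio ?mulf_neq0 ?oner_eq0 ?denom_ratioP //.
by rewrite mulr1 !mul1r mulrC.
Qed.

Lemma common_denominator (A : idomainType) (P : {poly {fraction A}}) :
  exists d P', d != 0 /\ map_poly (@tofrac A) P' = tofrac d *: P.
Proof.
elim/poly_ind: P => [|P c [d [P' [d0 P'E]]]].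
  by exists 1, 0; rewrite oner_eq0 rmorph0 scaler0.
have [n [e [e0 cE]]] := fracP c.
exists (d * e), (e *: P' * 'X + (d * n)%:P); split; first by rewrite mulf_neq0.
rewrite rmorphD rmorphM /= map_polyX map_polyC /= map_polyZ /= P'E.
rewrite scalerDr -!scalerAl scalerA mulrC -tofracM; congr (_ + _).
by rewrite -mul_polyC -polyCM !tofracM -mulrA cE.
Qed.

(** The formal top coefficient [c] may be zero, which makes the notion stable under products even
    when [A] has zero divisors. *)
Definition poly_bounded_coef (A : nzRingType) (p : {poly A}) (d : nat) (c : A) : Prop :=
  (size p <= d.+1)%N /\ p`_d = c.

Lemma poly_bounded_coefM (A : nzRingType) (p q : {poly A}) d e (a b : A) :
  poly_bounded_coef p d a -> poly_bounded_coef q e b ->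
  poly_bounded_coef (p * q) (d + e) (a * b).
Proof.
move=> [sp <-] [sq <-]; split.
  by apply: leq_trans (size_polyMleq _ _) _; move: (size p) (size q) sp sq; lia.
have ld : (d < (d + e).+1)%N by rewrite ltnS leq_addr.
rewrite coefM (bigD1 (Ordinal ld)) //= addKn big1 ?addr0 // => i ine.
have [di|di] := ltnP d i; first by rewrite nth_default ?mul0r // (leq_trans sp).
have {}di : (i < d)%N.
  by rewrite ltn_neqAle di andbT; apply: contraNneq ine => iE; apply/eqP/val_inj.
by rewrite [q`__]nth_default ?mulr0 // (leq_trans sq) //; move: di; lia.
Qed.

Lemma poly_bounded_coef_mmap1 (m : nat) (A : comNzRingType) (h : 'I_m -> {poly A}) (c : 'I_m -> A) (mo : 'X_{1..m}) :
  (forall i, poly_bounded_coef (h i) 1 (c i)) ->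
  poly_bounded_coef (mmap1 h mo) (mdeg mo) (mmap1 c mo).
Proof.
have b1 : poly_bounded_coef 1 0 1 by split; rewrite ?size_poly1 ?coef1.
move=> hc; rewrite mdegE /mmap1.
elim/big_rec3: _ => // i a d p _ IH; apply: poly_bounded_coefM => //.
by elim: (mo i) => // k IHk; rewrite !exprS -add1n; apply: poly_bounded_coefM.
Qed.

Lemma gauss_dvd_coef_map (F : fieldType) (A : comNzRingType)
    (g : {rmorphism A -> {poly F}}) (P Q C : {poly A}) :
  g (lead_coef P) != 0 -> g (lead_coef Q) != 0 ->
  (lead_coef P * lead_coef Q) *: C = P * Q ->
  forall i, g (lead_coef P) %| g P`_i.
Proof.
move=> gP gQ PQC i; rewrite -(coef_map g P i) -(lead_coef_map_eq gP).
apply: (@gauss_dvd_coef _ _ (map_poly g Q) (map_poly g C)).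
- by rewrite -lead_coef_eq0 lead_coef_map_eq.
- by rewrite -lead_coef_eq0 lead_coef_map_eq.
by rewrite !lead_coef_map_eq // -rmorphM -map_polyZ PQC rmorphM.
Qed.

(** * Divisibility in several variables, tested along lines *)

Section Lines.
Variables (F : fieldType) (m : nat).
Hypothesis F_infinite : forall s : seq F, exists c : F, c \notin s.
Implicit Types (D U : {mpoly F[m]}) (e v : 'I_m -> F).

(** Restriction to the line with direction [e] through the generic point; the outer variable is the
    parameter. In [line] the base point is specialized to [v]. *)
Definition generic_line e : {rmorphism {mpoly F[m]} -> {poly {mpoly F[m]}}} :=
  mmap (polyC \o @mpolyC m F) (fun i => ('X_i)%:P + (e i)%:MP *: 'X).

Definition line e v : {rmorphism {mpoly F[m]} -> {poly F}} :=
  map_poly (meval v) \o generic_line e.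

Lemma generic_line0 e D : (generic_line e D).[0] = D.
Proof.
rewrite -[LHS]/(horner_eval 0 _) rmorph_mmap -[RHS]mmap_id.
apply: eq_mmap => [c|i] /=; first by rewrite /horner_eval hornerC.
by rewrite /horner_eval hornerD hornerC hornerZ hornerX mulr0 addr0.
Qed.

(* The coefficient of top degree is the value at the direction of the leading
   form, hence a constant. *)
Lemma lead_coef_generic_line D : D != 0 ->
  exists e c, c != 0 /\ lead_coef (generic_line e D) = c%:MP.
Proof.
move=> D0; pose d := (msize D).-1.
have dE : msize D = d.+1 by rewrite /d -mlead_deg.
(* [T] is the leading form of [D], nonzero because the leading monomial has the full degree [d]. *)
pose T := \sum_(mo <- msupp D | mdeg mo == d) D@_mo *: 'X_[mo].
have T0 : T != 0.
  apply/eqP => T0; have lD : mdeg (mlead D) == d by rewrite -eqSS mlead_deg // dE.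
  have /eqP := congr1 (mcoeff (mlead D)) T0; rewrite mcoeff0 raddf_sum /=.
  rewrite big_mkcond (bigD1_seq (mlead D)) ?msupp_uniq ?mlead_supp //= lD.
  rewrite mcoeffZ mcoeffX eqxx mulr1 big1 ?addr0 ?mleadc_eq0 ?(negPf D0) // => mo moD.
  by rewrite mcoeffZ mcoeffX (negPf moD) mulr0 if_same.
have [e Te] := mpoly_nonroot F_infinite T0; exists e, T.@[e]; split=> //.
have termP mo : poly_bounded_coef
    (mmap1 (fun i => ('X_i)%:P + (e i)%:MP *: 'X : {poly {mpoly F[m]}}) mo)
    (mdeg mo) (mmap1 (fun i => (e i)%:MP) mo).
  apply: poly_bounded_coef_mmap1 => i; split.
    by rewrite addrC -[_%:MP *: _]mul_polyC size_MXaddC; case: ifP => // _; rewrite ltnS size_polyC_leq1.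
  by rewrite coefD coefC coefZ coefX mulr1 add0r.
have sD : (size (generic_line e D) <= d.+1)%N.
  apply: (leq_trans (size_sum _ _ _)); apply/bigmax_leqP_seq => mo moD _.
  rewrite mul_polyC; apply: leq_trans (size_scale_leq _ _) _.
  by rewrite -dE; have [smo _] := termP mo; apply: leq_trans smo (msize_mdeg_lt moD).
have cD : (generic_line e D)`_d = (T.@[e])%:MP.
  have -> : T.@[e] = \sum_(mo <- msupp D | mdeg mo == d) D@_mo * mmap1 e mo.
    by rewrite [LHS](raddf_sum (meval e)); apply: eq_bigr => mo _; rewrite /= mevalZ mevalX.
  rewrite coef_sum rmorph_sum /= [RHS]big_mkcond /= big_seq [RHS]big_seq.
  apply: eq_bigr => mo moD; rewrite coefCM; have [smo cmo] := termP mo.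
  have [<-|dmo] := eqVneq (mdeg mo) d.
    rewrite cmo rmorphM rmorph_prod; congr (_ * _).
    by apply: eq_bigr => i _; rewrite rmorphXn.
  rewrite nth_default ?mulr0 // (leq_trans smo) // ltn_neqAle dmo.
  by rewrite -ltnS -dE msize_mdeg_lt.
rewrite /lead_coef; suff -> : size (generic_line e D) = d.+1 by [].
apply/eqP; rewrite eqn_leq sD ltnNge; apply/negP => /leq_sizeP/(_ d (leqnn _)).
by rewrite cD => /eqP; rewrite mpolyC_eq0 (negPf Te).
Qed.

(** In the direction [e] the restriction of [D] is monic up to a constant, so that of [U] can be
    divided by it. At each base point the remainder is a multiple of a polynomial of larger degree,
    hence zero; parameter 0 gives back [U] and [D]. *)
Lemma mpoly_dvd_of_lines D U e c : c != 0 -> lead_coef (generic_line e D) = c%:MP ->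
  (forall v, line e v D %| line e v U) -> exists W, U = D * W.
Proof.
move=> c0 lD DU; pose V := c^-1%:MP *: generic_line e D.
have Vmon : V \is monic by rewrite monicE lead_coefZ lD -rmorphM mulVf ?rmorph1.
have [h [r [UE rV]]] := monic_rdivP (generic_line e U) Vmon.
have r0 : r = 0.
  apply/polyP => i; rewrite coef0; apply: (mpoly_fun_eq F_infinite) => v.
  rewrite meval0 -coef_map; suff -> : map_poly (meval v) r = 0 by rewrite coef0.
  have Vv : map_poly (meval v) V = c^-1 *: line e v D.
    by rewrite map_polyZ /= mevalC.
  have Vr : map_poly (meval v) V %| map_poly (meval v) r.
    have := DU v; rewrite /line /= UE rmorphD rmorphM /= Vv dvdp_addr //.
      by rewrite dvdpZl ?invr_neq0.
    by rewrite dvdp_mull // dvdpZr ?invr_neq0.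
  apply: contraTeq Vr => rv0; rewrite gtNdvdp //.
  apply: leq_ltn_trans (size_poly _ _) _; apply: leq_trans rV _.
  by rewrite size_map_poly_id0 // (eqP Vmon) meval1 oner_eq0.
exists (c^-1 *: h.[0]); rewrite -(generic_line0 e U) UE r0 addr0 hornerM hornerZ.
by rewrite generic_line0 mul_mpolyC -!scalerAr mulrC.
Qed.

(* Gauss's lemma for [F[x_1, ..., x_m]], reduced along lines to the principal
   ideal domain [F[s]]. *)
Lemma monic_factor_integral (P Q : {poly {fraction {mpoly F[m]}}})
    (C : {poly {mpoly F[m]}}) : P \is monic -> Q \is monic ->
  map_poly (@tofrac _) C = P * Q -> exists p, map_poly (@tofrac _) p = P.
Proof.
move=> Pmon Qmon CE.
have [d1 [P1 [d10 P1E]]] := common_denominator P.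
have [d2 [Q1 [d20 Q1E]]] := common_denominator Q.
pose D := d1 * d2; have D0 : D != 0 by rewrite mulf_neq0.
(* The cross scaling gives both polynomials the same leading coefficient [D]. *)
pose P2 := d2 *: P1; pose Q2 := d1 *: Q1.
have P2E : map_poly (@tofrac _) P2 = tofrac D *: P.
  by rewrite map_polyZ /= P1E scalerA -tofracM mulrC.
have Q2E : map_poly (@tofrac _) Q2 = tofrac D *: Q.
  by rewrite map_polyZ /= Q1E scalerA -tofracM.
have tofrac_inj : injective (@tofrac {mpoly F[m]}).
  by move=> u v /eqP; rewrite tofrac_eq => /eqP.
have lead2 (U : {poly {mpoly F[m]}}) V : V \is monic ->
    map_poly (@tofrac _) U = tofrac D *: V -> lead_coef U = D.
  move=> Vmon UE; apply/tofrac_inj.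
  by rewrite -(lead_coef_map_inj tofrac_inj (rmorph0 _)) UE lead_coefZ (eqP Vmon) mulr1.
have lP2 := lead2 _ _ Pmon P2E; have lQ2 := lead2 _ _ Qmon Q2E.
have PQC : (D * D) *: C = P2 * Q2.
  apply: (map_inj_poly tofrac_inj (rmorph0 _)).
  by rewrite rmorphM /= P2E Q2E map_polyZ /= CE tofracM -scalerAl -scalerAr scalerA.
have [e [c [c0 lD]]] := lead_coef_generic_line D0.
have lvD v : line e v D != 0.
  by rewrite /= -lead_coef_eq0 lead_coef_map_eq lD /= mevalC.
(* Along each line in the direction [e], [D] stays nonzero and Gauss's lemma over the univariate
   ring shows that it divides the coefficients of [P2]. *)
have [p pE] : exists p, P2 = D *: p.
  apply: poly_scale_factor => i; apply: (mpoly_dvd_of_lines c0 lD) => v.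
  rewrite -lP2; apply: (@gauss_dvd_coef_map _ _ _ P2 Q2 C).
  - by rewrite lP2.
  - by rewrite lQ2.
  - by rewrite lP2 lQ2.
exists p; have tD0 : tofrac D != 0 by rewrite tofrac_eq0.
by apply: (scalerI tD0); rewrite -P2E pE map_polyZ.
Qed.

End Lines.

(** * Coordinates *)

Section Naturality.
Variables (F : fieldType) (R : falgType F) (m : nat) (b : m.-tuple R).
Variables (B B' : comNzRingType) (g : {rmorphism B -> B'}).
Variables (iota : F -> B) (iota' : F -> B').
Hypothesis giota : g \o iota =1 iota'.

Lemma map_tmul (u v : 'rV[B]_m) :
  map_mx g (tmul b iota u v) = tmul b iota' (map_mx g u) (map_mx g v).
Proof.
apply/rowP => k; rewrite !mxE rmorph_sum; apply: eq_bigr => i _.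
by rewrite rmorph_sum; apply: eq_bigr => j _; rewrite !mxE !rmorphM -giota.
Qed.

Lemma map_texp (u : 'rV[B]_m) n :
  map_mx g (texp b iota u n) = texp b iota' (map_mx g u) n.
Proof.
elim: n => [|n IHn] /=; last by rewrite map_tmul IHn.
by apply/rowP => k; rewrite !mxE -giota.
Qed.

Lemma peval_widen (P : {poly B'}) (u : 'rV[B']_m) n : (size P <= n)%N ->
  peval b iota' P u = \sum_(i < n) P`_i *: texp b iota' u i.
Proof.
move=> Pn; rewrite /peval (big_ord_widen n (fun i => P`_i *: texp b iota' u i)) //.
rewrite big_mkcond /=; apply: eq_bigr => i _; case: ltnP => // Pi.
by rewrite nth_default // scale0r.
Qed.

Lemma map_peval (P : {poly B}) (u : 'rV[B]_m) :
  map_mx g (peval b iota P u) = peval b iota' (map_poly g P) (map_mx g u).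
Proof.
(* Applying [g] may lower the size, so both sums are taken up to the size of [P]. *)
rewrite (peval_widen _ (size_poly _ _)) /peval raddf_sum.
by apply: eq_bigr => i _; rewrite /= map_mxZ map_texp coef_map.
Qed.

Lemma map_NB (p : {mpoly F[m]}) (u : 'rV[B]_m) :
  g (NB iota p u) = NB iota' p (map_mx g u).
Proof. by rewrite /NB rmorph_mmap; apply: eq_mmap => // i; rewrite /= mxE. Qed.

Lemma map_chi (p : {mpoly F[m]}) (u : 'rV[B]_m) :
  map_poly g (chi b iota p u) = chi b iota' p (map_mx g u).
Proof.
rewrite /chi /NB rmorph_mmap; apply: eq_mmap => [c|i] /=.
  by rewrite map_polyC /= -giota.
by rewrite !mxE rmorphB rmorphM /= map_polyX !map_polyC /= -giota.
Qed.

End Naturality.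

(** * Elements as coordinate rows, specialization, and left multiplication *)

Section Coordinates.
Variables (F : fieldType) (R : falgType F) (m : nat) (b : m.-tuple R).
Hypothesis F_infinite : forall s : seq F, exists c : F, c \notin s.
Hypothesis b_basis : basis_of fullv b.
Implicit Types (r s : R) (p : {poly F}) (q : {poly {mpoly F[m]}}) (N : {mpoly F[m]}).

Definition coord_row r : 'rV[F]_m := \row_k coord b k r.

Definition of_coords (v : 'I_m -> F) : R := \sum_i v i *: tnth b i.

Lemma coordsK r : of_coords (coords b r) = r.
Proof.
rewrite [RHS](coord_basis b_basis (memvf r)).
by apply: eq_bigr => i _; rewrite (tnth_nth 0).
Qed.

Lemma of_coordsK v : coords b (of_coords v) =1 v.
Proof.
move=> k; rewrite /coords /of_coords.
rewrite -[RHS](coord_sum_free v k (basis_free b_basis)).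
by congr (coord b k _); apply: eq_bigr => i _; rewrite (tnth_nth 0).
Qed.

Lemma coord_row_inj : injective coord_row.
Proof.
move=> r s /rowP rs; rewrite -(coordsK r) -(coordsK s).
by apply: eq_bigr => i _; have := rs i; rewrite !mxE /coords => ->.
Qed.

Lemma coord_row_linear : linear coord_row.
Proof. by move=> c r s; apply/rowP => k; rewrite !mxE linearP. Qed.

HB.instance Definition _ := GRing.isLinear.Build F R 'rV[F]_m _ coord_row coord_row_linear.

Lemma tmul_coord_row r s :
  tmul b idfun (coord_row r) (coord_row s) = coord_row (r * s).
Proof.
apply/rowP => k; rewrite !mxE -{2}(coordsK r) -{2}(coordsK s).
rewrite mulr_suml linear_sum; apply: eq_bigr => i _.
rewrite mulr_sumr linear_sum; apply: eq_bigr => j _.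
by rewrite !mxE -scalerAl -scalerAr !linearZ /= mulrA.
Qed.

Lemma texp_coord_row r n : texp b idfun (coord_row r) n = coord_row (r ^+ n).
Proof. by elim: n => [|n IHn] /=; [apply/rowP => k; rewrite !mxE | rewrite IHn tmul_coord_row exprS]. Qed.

Lemma peval_coord_row r p :
  peval b idfun p (coord_row r) = coord_row (horner_alg r p).
Proof.
rewrite /horner_alg /horner_morph (horner_coef_wide _ (size_poly _ _)) linear_sum.
apply: eq_bigr => i _; rewrite coef_map /= mulr_algl linearZ /=.
by rewrite texp_coord_row.
Qed.

Lemma NB_coord_row N r : NB idfun N (coord_row r) = N.@[coords b r].
Proof. by apply: eq_mmap => // i; rewrite mxE. Qed.

Lemma mpoly_eq_coords (p q : {mpoly F[m]}) :
  (forall r, p.@[coords b r] = q.@[coords b r]) -> p = q.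
Proof.
move=> pq; apply: (mpoly_fun_eq F_infinite) => v.
by rewrite -(meval_eq p (of_coordsK v)) -(meval_eq q (of_coordsK v)).
Qed.

Definition at_elt r : {rmorphism {poly {mpoly F[m]}} -> {poly F}} :=
  map_poly (meval (coords b r)).

Lemma poly_mpoly_eq_coords (p q : {poly {mpoly F[m]}}) :
  (forall r c, (at_elt r p).[c] = (at_elt r q).[c]) -> p = q.
Proof.
move=> pq; apply/polyP => i; apply: mpoly_eq_coords => r.
have pqr : at_elt r p = at_elt r q by apply: (poly_fun_eq F_infinite) => c; apply: pq.
by have := congr1 (coefp i) pqr; rewrite /= !coef_map.
Qed.

(** Phrased through all specializations, so that it can be checked inside [R]. Over an infinite
    field this amounts to vanishing at the generic element, by [kills_genericE] and
    [kills_generic_frac]. *)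
Definition kills_generic (q : {poly {mpoly F[m]}}) : Prop :=
  forall r, horner_alg r (at_elt r q) = 0.

Definition generic_row : 'rV[{mpoly F[m]}]_m := \row_i 'X_i.

Lemma map_generic_row (B : comNzRingType) (iota : {rmorphism F -> B}) (u : 'rV[B]_m) :
  map_mx (mmap iota (fun i => u 0 i)) generic_row = u.
Proof. by apply/rowP => i; rewrite !mxE mmapX mmap1U. Qed.

Lemma kills_genericE q :
  kills_generic q <-> peval b (@mpolyC m F) q generic_row = 0.
Proof.
have evalE r : map_mx (meval (coords b r)) (peval b (@mpolyC m F) q generic_row) =
    coord_row (horner_alg r (at_elt r q)).
  rewrite (@map_peval _ _ _ _ _ _ _ _ idfun) => [|c]; last exact: mevalC.
  rewrite -peval_coord_row; congr (peval _ _ _ _).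
  by apply/rowP => i; rewrite !mxE /= mevalXU.
split=> [qk|q0 r]; last first.
  by apply: coord_row_inj; rewrite -evalE q0 map_mx0 linear0.
apply/rowP => k; rewrite mxE; apply: mpoly_eq_coords => r.
by have /rowP/(_ k) := evalE r; rewrite qk linear0 !mxE meval0.
Qed.

Lemma kills_generic_frac q :
  kills_generic q <-> peval b (@iotaK F m) (map_poly (@tofrac _) q) (generic_elt F m) = 0.
Proof.
rewrite kills_genericE.
have -> : generic_elt F m = map_mx (@tofrac _) generic_row.
  by apply/rowP => i; rewrite !mxE.
rewrite -(@map_peval _ _ _ _ _ _ _ (@mpolyC m F)) //.
split=> [->|/rowP q0]; first by rewrite map_mx0.
by apply/rowP => k; have /eqP := q0 k; rewrite !mxE tofrac_eq0 => /eqP.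
Qed.

(** Every row over [B] is a specialization of the generic row; this carries identities from points
    over [F] to all commutative algebras. *)
Lemma kills_generic_peval q (B : comNzRingType) (iota : {rmorphism F -> B}) (u : 'rV[B]_m) :
  kills_generic q -> peval b iota (map_poly (mmap iota (fun i => u 0 i)) q) u = 0.
Proof.
move/kills_genericE => q0; rewrite -[X in peval _ _ _ X](map_generic_row iota u).
rewrite -(@map_peval _ _ _ _ _ _ _ (@mpolyC m F)) ?q0 ?map_mx0 //.
by move=> c; apply: mmapC.
Qed.

Lemma chi_coord N (B : comNzRingType) (iota : {rmorphism F -> B}) (u : 'rV[B]_m) :
  chi b iota N u =
  map_poly (mmap iota (fun i => u 0 i)) (chi b (@mpolyC m F) N generic_row).
Proof.
rewrite (@map_chi _ _ _ _ _ _ _ _ iota) ?map_generic_row // => c.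
exact: mmapC.
Qed.

Lemma horner_chi N r c :
  (at_elt r (chi b (@mpolyC m F) N generic_row)).[c] = N.@[coords b (c%:A - r)].
Proof.
rewrite -[LHS]/(horner_eval c _) /chi /NB rmorph_mmap rmorph_mmap.
apply: eq_mmap => [a|i] /=.
  by rewrite map_polyC /horner_eval hornerC /= mevalC.
rewrite !mxE rmorphB rmorphM /= map_polyX !map_polyC /= mevalC mevalXU.
by rewrite /horner_eval !hornerE /coords linearB linearZ.
Qed.

(** Left multiplication by [r], written for row vectors; this reverses the order of products in
    [mulmx_eltM]. *)
Definition mulmx_elt r : 'M[F]_m := \matrix_(j, k) coord b k (r * tnth b j).

Lemma coord_row_mul r s : coord_row (r * s) = coord_row s *m mulmx_elt r.
Proof.
apply/rowP => k; rewrite !mxE -{1}(coordsK s) mulr_sumr linear_sum.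
by apply: eq_bigr => j _; rewrite !mxE -scalerAr linearZ.
Qed.

Lemma mulmx_eltM r s : mulmx_elt (r * s) = mulmx_elt s *m mulmx_elt r.
Proof.
apply/row_matrixP => j; rewrite row_mul.
have rowE t : row j (mulmx_elt t) = coord_row (t * tnth b j).
  by apply/rowP => k; rewrite !mxE.
by rewrite !rowE -mulrA coord_row_mul.
Qed.

Lemma mulmx_elt_alg c : mulmx_elt c%:A = c%:M.
Proof.
apply/matrixP => j k; rewrite !mxE mulr_algl linearZ /= (tnth_nth 0) coord_free.
  by rewrite eq_sym mulr_natr.
exact: basis_free b_basis.
Qed.

Lemma mulmx_eltB r s : mulmx_elt (r - s) = mulmx_elt r - mulmx_elt s.
Proof. by apply/matrixP => j k; rewrite !mxE mulrBl linearB. Qed.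

Definition norm_elt r : F := \det (mulmx_elt r).

Lemma norm_eltM r s : norm_elt (r * s) = norm_elt r * norm_elt s.
Proof. by rewrite /norm_elt mulmx_eltM det_mulmx mulrC. Qed.

Lemma horner_char_poly_elt r c : (char_poly (mulmx_elt r)).[c] = norm_elt (c%:A - r).
Proof.
rewrite /norm_elt mulmx_eltB mulmx_elt_alg -[LHS]/(horner_eval c _) -det_map_mx.
congr (\det _); apply/matrixP => i j; rewrite !mxE /= /horner_eval hornerD hornerN hornerC.
by rewrite hornerMn hornerX.
Qed.

Definition generic_mulmx : 'M[{mpoly F[m]}]_m :=
  \matrix_(j, k) \sum_i (sc b i j k)%:MP * 'X_i.

Lemma map_generic_mulmx r : map_mx (meval (coords b r)) generic_mulmx = mulmx_elt r.
Proof.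
apply/matrixP => j k; rewrite !mxE raddf_sum -{2}(coordsK r) mulr_suml linear_sum.
by apply: eq_bigr => i _; rewrite /= mevalM mevalC mevalXU -scalerAl linearZ mulrC.
Qed.

Lemma at_elt_char_poly r : at_elt r (char_poly generic_mulmx) = char_poly (mulmx_elt r).
Proof. by rewrite /= map_char_poly map_generic_mulmx. Qed.

End Coordinates.

(** Cayley-Hamilton for the matrix of left multiplication, applied to the unit of [R]. *)
Lemma kills_generic_char_poly (F : fieldType) (R : falgType F) (m : nat) (b : m.-tuple R) :
  basis_of fullv b -> kills_generic b (char_poly (generic_mulmx b)).
Proof.
(* Evaluating polynomials at matrices requires a positive size; with an empty basis every element is
   zero. *)
case: m b => [|m] b b_basis r.
  by rewrite -[LHS](coordsK b_basis) /of_coords big_ord0.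
rewrite at_elt_char_poly //.
have coord_row_horner p s : coord_row b (horner_alg r p * s) =
    coord_row b s *m horner_mx (mulmx_elt b r) p.
  elim/poly_ind: p s => [|p c IHp] s.
    by rewrite !rmorph0 mul0r mulmx0 linear0.
  rewrite !rmorphD {2}[p * _]mulrC !rmorphM /= horner_algX horner_algC horner_mx_X horner_mx_C.
  rewrite mulrDl linearD mulmxDr mulr_algl linearZ mul_mx_scalar; congr (_ + _).
  by rewrite -mulrA [LHS]IHp coord_row_mul // mulmxA.
apply: (coord_row_inj b_basis); rewrite -[LHS]/(coord_row b _) -[X in coord_row b X]mulr1.
by rewrite coord_row_horner Cayley_Hamilton mulmx0 linear0.
Qed.

Lemma horner_alg_comp (F : fieldType) (R : falgType F) (r : R) (p q : {poly F}) :
  horner_alg r (p \Po q) = horner_alg (horner_alg r q) p.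
Proof.
elim/poly_ind: p => [|p c IHp]; first by rewrite comp_poly0 !rmorph0.
by rewrite comp_polyD comp_polyM comp_polyX comp_polyC !rmorphD !rmorphM /= IHp
  horner_algX !horner_algC.
Qed.

(** * Multiplicativity over all commutative algebras, via a generic pair *)

Section Multiplicativity.
Variables (F : fieldType) (R : falgType F) (m : nat) (b : m.-tuple R).
Hypothesis F_infinite : forall s : seq F, exists c : F, c \notin s.
Hypothesis b_basis : basis_of fullv b.

Definition generic_left : 'rV[{mpoly F[m + m]}]_m := \row_i 'X_(lshift m i).
Definition generic_right : 'rV[{mpoly F[m + m]}]_m := \row_i 'X_(rshift m i).

Definition pair_point (B : Type) (u v : 'rV[B]_m) (i : 'I_(m + m)) : B :=
  match split i with inl j => u 0 j | inr j => v 0 j end.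

Lemma map_generic_left (B : comNzRingType) (iota : {rmorphism F -> B}) (u v : 'rV[B]_m) :
  map_mx (mmap iota (pair_point u v)) generic_left = u.
Proof.
apply/rowP => i; rewrite !mxE /= mmapX mmap1U /pair_point.
by rewrite -[lshift m i]/(unsplit (inl _)) unsplitK.
Qed.

Lemma map_generic_right (B : comNzRingType) (iota : {rmorphism F -> B}) (u v : 'rV[B]_m) :
  map_mx (mmap iota (pair_point u v)) generic_right = v.
Proof.
apply/rowP => i; rewrite !mxE /= mmapX mmap1U /pair_point.
by rewrite -[rshift m i]/(unsplit (inr _)) unsplitK.
Qed.

(** An identity between polynomials in [m + m] variables, which holds because it holds at all points
    over the infinite field. *)
Lemma generic_pair_mul (f : {mpoly F[m]}) : multiplicative_pf b f ->
  NB (@mpolyC (m + m) F) f (tmul b (@mpolyC _ F) generic_left generic_right) =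
  NB (@mpolyC (m + m) F) f generic_left * NB (@mpolyC (m + m) F) f generic_right.
Proof.
move=> fM; apply: (mpoly_fun_eq F_infinite) => w.
have evC : meval w \o @mpolyC _ F =1 idfun by move=> c; apply: mevalC.
have lE : map_mx (meval w) generic_left = coord_row b (of_coords b (fun i => w (lshift m i))).
  by apply/rowP => i; rewrite !mxE /= mevalXU -[RHS]/(coords b _ i) of_coordsK.
have rE : map_mx (meval w) generic_right = coord_row b (of_coords b (fun i => w (rshift m i))).
  by apply/rowP => i; rewrite !mxE /= mevalXU -[RHS]/(coords b _ i) of_coordsK.
rewrite [RHS]mevalM [LHS](map_NB evC) [X in X * _](map_NB evC) [X in _ * X](map_NB evC).
rewrite (map_tmul _ evC) lE rE.
by rewrite tmul_coord_row // !NB_coord_row.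
Qed.

Lemma NB_mul_of_generic (f : {mpoly F[m]}) :
  NB (@mpolyC (m + m) F) f (tmul b (@mpolyC _ F) generic_left generic_right) =
  NB (@mpolyC (m + m) F) f generic_left * NB (@mpolyC (m + m) F) f generic_right ->
  forall (B : comNzRingType) (iota : {rmorphism F -> B}) (u v : 'rV[B]_m),
  NB iota f (tmul b iota u v) = NB iota f u * NB iota f v.
Proof.
move=> fM B iota u v; pose h := mmap iota (pair_point u v).
have hC : h \o @mpolyC _ F =1 iota by move=> c; apply: mmapC.
have : NB iota f (map_mx h (tmul b (@mpolyC _ F) generic_left generic_right)) =
    NB iota f (map_mx h generic_left) * NB iota f (map_mx h generic_right).
  rewrite -[LHS](map_NB hC) -[X in X * _](map_NB hC) -[X in _ * X](map_NB hC) fM.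
  exact: rmorphM.
by rewrite (map_tmul _ hC) map_generic_left map_generic_right.
Qed.

Lemma multiplicative_pf_NB (f : {mpoly F[m]}) :
  (forall u v, NB idfun f (tmul b idfun u v) = NB idfun f u * NB idfun f v) ->
  multiplicative_pf b f.
Proof. by move=> fM r s; rewrite -!NB_coord_row -tmul_coord_row. Qed.

(** At a generic pair [(x, y)] the hypotheses give [g(x y) f(x y) = g(x) g(y) f(x y)] in an integral
    domain. There [f(x y)] is cancellable, since its value at [(1, 1)] is 1, whereas at individual
    points it could vanish. *)
Lemma multiplicative_pf_div (N g f : {mpoly F[m]}) :
  N = g * f -> f.@[coords b 1] = 1 ->
  multiplicative_pf b N -> multiplicative_pf b f -> multiplicative_pf b g.
Proof.
move=> -> f1 /generic_pair_mul NM /generic_pair_mul fM.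
apply: multiplicative_pf_NB; apply: NB_mul_of_generic.
have NBM u : NB (@mpolyC (m + m) F) (g * f) u =
    NB (@mpolyC (m + m) F) g u * NB (@mpolyC (m + m) F) f u.
  exact: (rmorphM (mmap (@mpolyC (m + m) F) (fun i => u 0 i))).
apply: (@mulIf _ (NB (@mpolyC (m + m) F) f (tmul b (@mpolyC _ F) generic_left generic_right)));
  last first.
  apply: etrans (esym (NBM _)) (etrans NM _).
  apply: etrans (f_equal2 *%R (NBM _) (NBM _)) (etrans (mulrACA _ _ _ _) _).
  by congr (_ * _); rewrite fM.
apply/eqP => f0.
pose one := coord_row b 1.
have := congr1 (mmap idfun (pair_point one one)) f0.
have hC : mmap idfun (pair_point one one) \o @mpolyC _ F =1 idfun by move=> c; apply: mmapC.
rewrite [RHS]rmorph0 [LHS](map_NB hC) (map_tmul _ hC) map_generic_left map_generic_right.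
by rewrite tmul_coord_row // mulr1 NB_coord_row f1 => /eqP; rewrite oner_eq0.
Qed.

End Multiplicativity.

(** * The minimal polynomial of the generic element *)

Section MinimalPolynomial.
Variables (F : fieldType) (R : falgType F) (m : nat) (b : m.-tuple R).
Hypothesis F_infinite : forall s : seq F, exists c : F, c \notin s.
Hypothesis b_basis : basis_of fullv b.
Variable p : {poly {mpoly F[m]}}.
Hypothesis p_monic : p \is monic.
Hypothesis p_kills : kills_generic b p.
Hypothesis p_min : forall q, q != 0 -> kills_generic b q -> (size p <= size q)%N.
Implicit Types (r s : R) (c l : F).

Let k := (size p).-1.
Definition minpoly_norm : {mpoly F[m]} := (-1) ^+ (size p).-1 * p`_0.
Let f := minpoly_norm.
Local Notation "q ~_ r" := (at_elt b r q) (at level 3, r at level 2, format "q ~_ r") : ring_scope.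
Local Notation fn g r := (g.@[coords b r]).

Lemma size_pE : size p = k.+1.
Proof. by rewrite /k prednK // size_poly_gt0 monic_neq0. Qed.

Lemma kills_generic_dvd q : kills_generic b q -> exists h, q = h * p.
Proof.
move=> qk; have [h [r [qE rp]]] := monic_rdivP q p_monic.
have [r0|r0] := eqVneq r 0; first by exists h; rewrite qE r0 addr0.
have : (size p <= size r)%N.
  apply: p_min r0 _ => s; have := qk s.
  by rewrite qE rmorphD rmorphM /= rmorphD rmorphM /= p_kills mulr0 add0r.
by rewrite leqNgt rp.
Qed.

Definition affine_subst l c : {rmorphism {mpoly F[m]} -> {mpoly F[m]}} :=
  mmap (@mpolyC m F) (fun i => l *: 'X_i + (c * coord b i 1)%:MP).

Lemma eval_affine_subst l c r (g : {mpoly F[m]}) :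
  fn (affine_subst l c g) r = fn g (l *: r + c%:A).
Proof.
rewrite [LHS]rmorph_mmap; apply: eq_mmap => [a|i] /=; first exact: mevalC.
by rewrite mevalD mevalZ mevalXU mevalC /coords linearD !linearZ.
Qed.

Lemma at_elt_affine_subst l c r (q : {poly {mpoly F[m]}}) :
  (map_poly (affine_subst l c) q)~_r = q~_(l *: r + c%:A).
Proof. by apply/polyP => i; rewrite !coef_map /= eval_affine_subst. Qed.

(* Both sides are the minimal polynomial of the generic element, up to an affine
   change of variables. *)
Lemma minpoly_affine l c r t : l != 0 ->
  (p~_(l *: r + c%:A)).[l * t + c] = l ^+ k * (p~_r).[t].
Proof.
move=> l0; pose u : {poly {mpoly F[m]}} := l%:MP *: 'X + (c%:MP)%:P.
have lP0 : l%:MP_[m] != 0 by rewrite mpolyC_eq0.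
have su : size u = 2.
  by rewrite /u size_polyDl size_scale ?size_polyX // ltnS size_polyC_leq1.
have lu : lead_coef u = l%:MP.
  by rewrite /u lead_coefDl ?lead_coefZ ?lead_coefX ?mulr1 // size_scale // size_polyX ltnS size_polyC_leq1.
pose p' := map_poly (affine_subst l c) p.
have p'mon : p' \is monic by apply: monic_map.
have sp' : size p' = size p by rewrite size_map_poly_id0 // (eqP p_monic) rmorph1 oner_eq0.
(* The specialization of [q] at [s] is [l^-k p_(l s + c)(l t + c)]; the factor [l^-k] makes [q]
   monic. *)
pose q := ((l ^- k)%:MP) *: (p' \Po u).
have lk0 : (l ^- k)%:MP_[m] != 0 by rewrite mpolyC_eq0 invr_eq0 expf_neq0.
have sq : size q = size p by rewrite size_scale // size_comp_poly2.
have qmon : q \is monic.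
  rewrite monicE lead_coefZ lead_coef_comp ?su // lu sp' (eqP p'mon) mul1r.
  by rewrite -rmorphXn -rmorphM mulVf ?rmorph1 // expf_neq0.
have qE s : q~_s = (l ^- k) *: (p~_(l *: s + c%:A) \Po (l *: 'X + c%:P)).
  rewrite /q /= map_polyZ /= mevalC map_comp_poly -[map_poly _ p']/(p'~_s).
  by rewrite at_elt_affine_subst rmorphD /= map_polyZ map_polyX map_polyC /= !mevalC.
have qk : kills_generic b q.
  move=> s; rewrite qE linearZ /= horner_alg_comp.
  have -> : horner_alg s (l *: 'X + c%:P) = l *: s + c%:A.
    by rewrite linearD linearZ /= horner_algX horner_algC mulr_algl.
  by rewrite p_kills mulr0.
(* Both are monic of degree [k] and kill the generic element, so a nonzero difference would
   contradict minimality. *)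
have qp : q = p.
  apply/eqP; rewrite -subr_eq0; apply: contraT => /p_min.
  have /[swap]/[apply] : kills_generic b (q - p).
    by move=> s; rewrite rmorphB rmorphB /= qk p_kills subrr.
  rewrite leqNgt; case/negP; rewrite size_pE ltnS; apply/leq_sizeP => j.
  rewrite coefB leq_eqVlt => /predU1P[<-|kj]; last first.
    by rewrite !nth_default ?subrr ?sq ?size_pE.
  by move: (monicP qmon) (monicP p_monic); rewrite !lead_coefE sq => -> ->; rewrite subrr.
have <- : (q~_r).[t] = (p~_r).[t] by rewrite qp.
rewrite qE hornerZ horner_comp hornerD hornerZ hornerX hornerC mulrA.
by rewrite mulfV ?expf_neq0 // mul1r.
Qed.

Lemma eval_minpoly_norm r : fn f r = (-1) ^+ k * (p~_r).[0].
Proof.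
by rewrite /f /minpoly_norm mevalM rmorphXn rmorphN1 horner_coef0 coef_map.
Qed.

(** The case [l = -1], [t = c] of [minpoly_affine], in which [l t + c = 0]. *)
Lemma minpoly_norm_sub r c : fn f (c%:A - r) = (p~_r).[c].
Proof.
have := @minpoly_affine (-1) c r c; rewrite oppr_eq0 oner_eq0 => /(_ isT).
rewrite mulN1r addNr scaleN1r addrC eval_minpoly_norm => ->.
by rewrite mulrA -expr2 sqrr_sign mul1r.
Qed.

Lemma minpoly_normZ l r : l != 0 -> fn f (l *: r) = l ^+ k * fn f r.
Proof.
move=> l0; have := @minpoly_affine l 0 r 0 l0.
by rewrite scale0r mulr0 !addr0 !eval_minpoly_norm => ->; rewrite mulrCA.
Qed.

(** Here [f(1) = p_0(1)], and scaling gives [p_0(l) = l^k p_0(1)] for nonzero [l]. Thus [p_0] is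
    [f(1)] times a power of the variable, and it is monic. *)
Lemma minpoly_norm1 : fn f 1 = 1.
Proof.
have f1 : fn f 1 = (p~_0).[1] by rewrite -minpoly_norm_sub subr0 scale1r.
(* The extra factor ['X] makes the two sides agree at 0, where scaling says nothing. *)
have pX : 'X * p~_0 = 'X * (fn f 1 *: 'X^k).
  apply: (poly_fun_eq F_infinite) => l; rewrite !hornerM hornerX hornerZ hornerXn.
  have [->|l0] := eqVneq l 0; first by rewrite !mul0r.
  have := @minpoly_affine l 0 0 1 l0.
  by rewrite scaler0 scale0r !addr0 mulr1 f1 => ->; congr (_ * _); apply: mulrC.
have X0 : 'X != 0 :> {poly F} by rewrite polyX_eq0.
have := monic_map (meval (coords b 0)) p_monic.
rewrite monicE -[map_poly _ p]/(p~_0) (mulfI X0 pX).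
by rewrite lead_coefZ lead_coefXn mulr1 => /eqP.
Qed.

(** Comparing coefficients in [f(l x) = l^k f(x)], a monomial of degree [d] in the support gives
    [l^d = l^k] for every nonzero [l], hence [d = k]. *)
Lemma minpoly_norm_homog : homog_deg k f.
Proof.
apply/allP => mo mof.
have coefE l : l != 0 -> f@_mo * l ^+ mdeg mo = l ^+ k * f@_mo.
  move=> l0; pose g := \sum_(mo' <- msupp f) (f@_mo' * l ^+ mdeg mo') *: 'X_[mo'] : {mpoly F[m]}.
  have gf : g = l ^+ k *: f.
    apply: (mpoly_eq_coords F_infinite b_basis) => r.
    rewrite mevalZ -minpoly_normZ // [LHS](raddf_sum (meval _)) [RHS]mevalE.
    apply: eq_bigr => mo' _; rewrite /= mevalZ mevalX -mulrA; congr (_ * _).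
    rewrite mdegE -prodrXr -big_split; apply: eq_bigr => i _ /=.
    by rewrite /coords linearZ exprMn.
  have := congr1 (mcoeff mo) gf; rewrite mcoeffZ => <-.
  rewrite raddf_sum (bigD1_seq mo) ?msupp_uniq //= mcoeffZ mcoeffX eqxx mulr1.
  by rewrite big1 ?addr0 // => mo' moN; rewrite mcoeffZ mcoeffX (negPf moN) mulr0.
have XX : 'X * 'X^(mdeg mo) = 'X * 'X^k :> {poly F}.
  apply: (poly_fun_eq F_infinite) => l; rewrite !hornerM hornerX !hornerXn.
  have [->|l0] := eqVneq l 0; first by rewrite !mul0r.
  congr (_ * _); move: mof; rewrite mcoeff_msupp => fmo.
  by apply: (mulIf fmo); rewrite -coefE // mulrC.
have X0 : 'X != 0 :> {poly F} by rewrite polyX_eq0.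
by have := congr1 (fun q : {poly F} => size q) (mulfI X0 XX); rewrite !size_polyXn => -[->].
Qed.

Lemma chi_minpoly_norm : chi b (@mpolyC m F) f (generic_row F m) = p.
Proof.
apply: (poly_mpoly_eq_coords F_infinite b_basis) => r c.
by rewrite horner_chi minpoly_norm_sub.
Qed.

Definition restrict_line (g : {mpoly F[m]}) r s : {poly F} :=
  mmap polyC (fun i => (coord b i r)%:P + coord b i s *: 'X) g.

Lemma horner_restrict_line g r s c : (restrict_line g r s).[c] = fn g (r + c *: s).
Proof.
rewrite -[LHS]/(horner_eval c _) rmorph_mmap; apply: eq_mmap => [a|i] /=.
  by rewrite /horner_eval hornerC.
by rewrite /horner_eval hornerD hornerC hornerZ hornerX /coords linearD linearZ mulrC.
Qed.

Lemma restrict_line_minpoly_norm r s :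
  poly_bounded_coef (restrict_line f r s) k (fn f s).
Proof.
have termP mo : mo \in msupp f -> poly_bounded_coef
    (mmap1 (fun i => (coord b i r)%:P + coord b i s *: 'X) mo) k (mmap1 (coords b s) mo).
  move=> mof; rewrite -(eqP (allP minpoly_norm_homog _ mof)).
  apply: poly_bounded_coef_mmap1 => i; split.
    by rewrite addrC -[_ *: 'X]mul_polyC size_MXaddC; case: ifP => // _; rewrite ltnS size_polyC_leq1.
  by rewrite coefD coefC coefZ coefX mulr1 add0r.
split.
  apply: (leq_trans (size_sum _ _ _)); apply/bigmax_leqP_seq => mo mof _.
  by rewrite mul_polyC; apply: leq_trans (size_scale_leq _ _) _; case: (termP mo mof).
rewrite coef_sum [RHS]mevalE big_seq [RHS]big_seq; apply: eq_bigr => mo mof.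
by rewrite coefCM; case: (termP mo mof) => _ ->.
Qed.

(** Write [q = h * p] and evaluate at [t = 0] over the element [- r]. Used for the determinant of
    left multiplication and for an arbitrary Cayley-Hamilton norm. *)
Lemma kills_generic_norm_factor (q : {poly {mpoly F[m]}}) (phi : R -> F) :
  kills_generic b q -> (forall r, (q~_r).[0] = phi (- r)) ->
  exists w, forall r, phi r = fn w r * fn f r.
Proof.
move=> /kills_generic_dvd[h ->] phiE; exists (affine_subst (-1) 0 h`_0) => r.
rewrite eval_affine_subst scale0r addr0 scaleN1r -[in LHS](opprK r) -phiE.
have -> : fn f r = (p~_(- r)).[0] by rewrite -minpoly_norm_sub scale0r add0r opprK.
by rewrite rmorphM hornerM [in LHS](horner_coef0 (h~_(- r))) coef_map.
Qed.

Lemma minpoly_normM : multiplicative_pf b f.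
Proof.
move=> r s.
have [w wE] : exists w, forall t, norm_elt b t = fn w t * fn f t.
  apply: (@kills_generic_norm_factor _ _ (kills_generic_char_poly b_basis)) => t.
  by rewrite at_elt_char_poly // horner_char_poly_elt // scale0r add0r.
have pE t c : (p~_(- t)).[c] = fn f (c%:A + t) by rewrite -minpoly_norm_sub opprK.
have charE t c : (char_poly (mulmx_elt b (- t))).[c] = norm_elt b (c%:A + t).
  by rewrite horner_char_poly_elt // opprK.
have [ds dsP] := monic_divisors_finite (monic_neq0 (char_poly_monic (mulmx_elt b (- s)))).
(* As a polynomial in [T], this is [f((T + r) s) - d(0) f(T + r)]. *)
pose e (d : {poly F}) := restrict_line f (r * s) s - d.[0] *: p~_(- r).
(* The last factor is [det L_(T + r)]; it takes care of the values of [T] at which left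
   multiplication is singular. *)
have : \prod_(d <- ds) e d * char_poly (mulmx_elt b (- r)) = 0.
  apply: (poly_fun_eq F_infinite) => c; rewrite hornerM horner_prod charE horner0.
  set a := c%:A + r; have [->|na] := eqVneq (norm_elt b a) 0; first by rewrite mulr0.
  have fa : fn f a != 0 by apply: contraNneq na => fa; rewrite wE fa mulr0.
  (* In the variable [S] this is [f(a (S + s))], with leading coefficient [f(a)]. *)
  pose phi := restrict_line f (a * s) a.
  have [sphi cphi] := restrict_line_minpoly_norm (a * s) a.
  have lphi : lead_coef phi = fn f a.
    rewrite /lead_coef; suff -> : size phi = k.+1 by [].
    apply/eqP; rewrite eqn_leq sphi ltnNge; apply/negP => /leq_sizeP/(_ k (leqnn _)) phik.
    by move: fa; rewrite -cphi phik eqxx.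
  pose d := (fn f a)^-1 *: phi.
  have dmon : d \is monic by rewrite monicE lead_coefZ lphi mulVf.
  (* Multiplying [phi] by [w(a (S + s))] gives [det L_a det L_(S + s)], and [det L_a] is a nonzero
     constant. *)
  have dB : d %| char_poly (mulmx_elt b (- s)).
    rewrite dvdpZl ?invr_neq0 // -(dvdpZr _ _ na); apply/dvdpP.
    exists (restrict_line w (a * s) a); apply: (poly_fun_eq F_infinite) => t.
    rewrite hornerM !horner_restrict_line hornerZ charE -wE -norm_eltM //.
    by rewrite mulrDr mulr_algr addrC.
  have ed : (e d).[c] = 0.
    rewrite hornerD hornerN !hornerZ !horner_restrict_line pE -/a scale0r addr0.
    by rewrite mulrAC mulVf // mul1r /a mulrDl mulr_algl [c *: s + _]addrC subrr.
  apply/eqP; rewrite mulf_eq0; apply/orP; left; rewrite prodf_seq_eq0.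
  by apply/hasP; exists d; rewrite ?dsP //= ed eqxx.
(* A zero product of polynomials has a zero factor, so a single [d] works for all [T]. The
   coefficients of [T^k] then give [d(0) = f(s)], and [T = 0] gives the claim. *)
move/eqP; rewrite mulf_eq0 (negPf (monic_neq0 (char_poly_monic _))) orbF prodf_seq_eq0.
case/hasP => d _ /=; rewrite subr_eq0 => /eqP eE.
have sd : fn f s = d.[0].
  have [_ <-] := restrict_line_minpoly_norm (r * s) s.
  rewrite eE coefZ; have /monicP := monic_map (meval (coords b (- r))) p_monic.
  rewrite lead_coefE size_map_poly_id0; last by rewrite (eqP p_monic) rmorph1 oner_eq0.
  by move=> ->; rewrite mulr1.
have := congr1 (horner^~ 0) eE; rewrite /= horner_restrict_line hornerZ pE !scale0r addr0 add0r.
by rewrite -sd mulrC.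
Qed.

Lemma minpoly_norm_CHnorm : is_CHnorm b f.
Proof.
split; first by exists k; apply: minpoly_norm_homog.
split=> B iota u.
  move=> v; apply: NB_mul_of_generic.
  exact: (generic_pair_mul F_infinite b_basis minpoly_normM).
by rewrite chi_coord chi_minpoly_norm kills_generic_peval.
Qed.

Lemma CHnorm_factor N : is_CHnorm b N ->
  exists2 g, multiplicative_pf b g & forall r, fn N r = fn g r * fn f r.
Proof.
move=> [_ [NM Nchi]].
have [g gE] : exists g, forall r, fn N r = fn g r * fn f r.
  apply: (@kills_generic_norm_factor (chi b (@mpolyC m F) N (generic_row F m))) => r.
    apply: (coord_row_inj b_basis); rewrite linear0 -peval_coord_row //.
    have := Nchi F idfun (coord_row b r); rewrite chi_coord => NE; rewrite -[RHS]NE.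
    congr (peval _ _ _ _); apply: eq_map_poly => q; apply: eq_mmap => // i.
    by rewrite mxE.
  by rewrite horner_chi // scale0r add0r.
exists g => //; apply: (multiplicative_pf_div F_infinite b_basis (N := N) (f := f)).
- by apply: (mpoly_eq_coords F_infinite b_basis) => r; rewrite mevalM.
- exact: minpoly_norm1.
- by apply: (multiplicative_pf_NB b_basis) => u v; apply: (NM F idfun).
exact: minpoly_normM.
Qed.

End MinimalPolynomial.

(** * From the fraction field to polynomial coefficients *)

Lemma pevalZ (F : fieldType) (R : falgType F) (m : nat) (b : m.-tuple R)
    (B : comNzRingType) (iota : F -> B) (c : B) (P : {poly B}) (u : 'rV[B]_m) :
  peval b iota (c *: P) u = c *: peval b iota P u.
Proof.
rewrite (peval_widen _ _ _ (size_scale_leq c P)) scaler_sumr.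
by apply: eq_bigr => i _; rewrite coefZ scalerA.
Qed.

Theorem theorem2p6 (F : fieldType) (R : falgType F) (m : nat) (b : m.-tuple R)
  (F_infinite : forall s : seq F, exists c : F, c \notin s)
  (b_basis : basis_of fullv b)
  (P : {poly genK F m})
  (P_monic : P \is monic)
  (P_root : peval b (@iotaK F m) P (generic_elt F m) = 0)
  (P_min : forall Q : {poly genK F m}, Q != 0 ->
             peval b (@iotaK F m) Q (generic_elt F m) = 0 -> (size P <= size Q)%N) :
  exists f : {mpoly F[m]},
    tofrac f = (-1) ^+ (size P).-1 * P`_0 /\
    is_CHnorm b f /\
    (forall N : {mpoly F[m]}, is_CHnorm b N ->
       exists g : {mpoly F[m]},
         multiplicative_pf b g /\
         (forall r : R, N.@[coords b r] = g.@[coords b r] * f.@[coords b r])).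
Proof.
pose toK := map_poly (@tofrac {mpoly F[m]}).
have tofrac_inj : injective (@tofrac {mpoly F[m]}).
  by move=> u v /eqP; rewrite tofrac_eq => /eqP.
have size_toK q : size (toK q) = size q by rewrite size_map_inj_poly ?rmorph0.
have min q : q != 0 -> kills_generic b q -> (size P <= size q)%N.
  move=> q0 /(kills_generic_frac F_infinite b_basis); rewrite -size_toK; apply: P_min.
  by rewrite -size_poly_eq0 size_toK size_poly_eq0.
pose C := char_poly (generic_mulmx b).
have [d [P1 [d0 P1E]]] := common_denominator P.
have td0 : tofrac d != 0 by rewrite tofrac_eq0.
have P1k : kills_generic b P1.
  by apply/(kills_generic_frac F_infinite b_basis); rewrite P1E pevalZ P_root scaler0.
have sP1 : size P1 = size P by rewrite -size_toK /toK P1E size_scale.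
have P10 : P1 != 0 by rewrite -size_poly_eq0 sP1 size_poly_eq0 monic_neq0.
(* Pseudo-division over the polynomial ring, with [a] a power of the leading coefficient of [P1].
   The remainder kills the generic element and is shorter than [P], so it vanishes. *)
have CE := Pdiv.Idomain.divp_eq C P1.
set a := _ ^+ _ in CE; set h := (_ %/ _)%R in CE.
have a0 : a != 0 by rewrite expf_neq0 // lead_coef_eq0.
have C0 : C %% P1 = 0.
  apply/eqP/negPn/negP => r0; have := ltn_modpN0 C P10; rewrite sP1 ltnNge min // => r.
  have := congr1 (fun q => horner_alg r (at_elt b r q)) CE.
  rewrite -mul_polyC !(rmorphD, rmorphM) /= P1k mulr0 add0r => <-.
  by rewrite [X in _ * X](kills_generic_char_poly b_basis) mulr0.
(* From [a C = h P1] and [P1 = d P] the cofactor of [P] in [C] is [(d / a) h]; it is monic because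
   [C] and [P] are. *)
pose Q := (tofrac d / tofrac a) *: toK h.
have CQP : toK C = P * Q.
  have ta0 : tofrac a != 0 by rewrite tofrac_eq0.
  apply: (scalerI ta0); have := congr1 toK CE.
  rewrite C0 addr0 [LHS]map_polyZ [RHS]rmorphM => ->.
  by rewrite [X in _ * X]P1E -!scalerAr scalerA mulrCA mulfV // mulr1 mulrC.
have Qmon : Q \is monic.
  have : toK C \is monic by rewrite monic_map ?char_poly_monic.
  by rewrite !monicE CQP lead_coefM (eqP P_monic) mul1r.
have [p pE] := monic_factor_integral F_infinite P_monic Qmon CQP.
have p_monic : p \is monic.
  by rewrite monicE -(inj_eq tofrac_inj) -(lead_coef_map_inj tofrac_inj (rmorph0 _)) pE
     (eqP P_monic) rmorph1.
have p_kills : kills_generic b p by apply/(kills_generic_frac F_infinite b_basis); rewrite pE.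
have sp : size p = size P by rewrite -size_toK /toK pE.
have p_min q : q != 0 -> kills_generic b q -> (size p <= size q)%N by rewrite sp; apply: min.
exists (minpoly_norm p); split.
  by rewrite /minpoly_norm tofracM rmorphXn rmorphN1 sp -pE coef_map.
split; first exact: (minpoly_norm_CHnorm F_infinite b_basis p_monic p_kills p_min).
by move=> N /(CHnorm_factor F_infinite b_basis p_monic p_kills p_min)[g gM gE]; exists g.
Qed.
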